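(* As $n \to \infty$, $$\sigma\mathrm{Mex}(n) \sim 2\, \sigma_{e}\mathrm{Mex}(n).$$
   Context: An overpartition of a non-negative integer $n$ is a partition of $n$ (a finite non-increasing sequence of positive integers with sum $n$) in which the first occurrence of each distinct part may or may not be overlined. Let $\bar{P}(n)$ be the set of all overpartitions of $n$. For $\lambda\in\bar P(n)$, $\mathrm{Mex}(\lambda)$ is the smallest positive integer that does not occur as a part of $\lambda$, whether overlined or non-overlined. Let $\mathrm{Mex}_e(\lambda)=\mathrm{Mex}(\lambda)$ if $\mathrm{Mex}(\lambda)$ is even, and $\mathrm{Mex}_e(\lambda)=0$ otherwise. Define $\sigma\mathrm{Mex}(n)=\sum_{\lambda\in\bar P(n)}\mathrm{Mex}(\lambda)$ and $\sigma_e\mathrm{Mex}(n)=\sum_{\lambda\in\bar P(n)}\mathrm{Mex}_e(\lambda)$. The notation $a(n)\sim b(n)$ means $a(n)/b(n)\to 1$. *)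

(* Defs.v *)
From mathcomp Require Import all_boot all_order all_algebra.
From mathcomp Require Import all_classical all_reals all_analysis.

Set Implicit Arguments.
Unset Strict Implicit.
Unset Printing Implicit Defensive.

Import Order.TTheory GRing.Theory Num.Theory.
Import numFieldNormedType.Exports.

Local Open Scope nat_scope.

(* A part is a pair (size, overlined?). *)
Definition parts (s : seq (nat * bool)) : seq nat := [seq x.1 | x <- s].

(* The last clause says that an overlined part differs in size from every part
   that precedes it, i.e. only first occurrences may be overlined. *)
Definition is_overpartition (n : nat) (s : seq (nat * bool)) : bool :=
  [&& sorted geq (parts s),
      all (fun k => 0 < k) (parts s),
      sumn (parts s) == n &
      pairwise (fun x y : nat * bool => y.2 ==> (x.1 != y.1)) s].

(* An overpartition of n has at most n parts, each at most n, so bounding the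
   length and the parts loses nothing (overpartition_complete below) and gives
   a finite type to sum over. *)
Definition seq_of_bseq (n : nat) (s : n.-bseq ('I_n.+1 * bool)) :
    seq (nat * bool) :=
  [seq (nat_of_ord x.1, x.2) | x <- s].

Definition overpartition (n : nat) : finType :=
  {s : n.-bseq ('I_n.+1 * bool) | is_overpartition n (seq_of_bseq s)}.

Definition overpartition_seq (n : nat) (l : overpartition n) :
    seq (nat * bool) := seq_of_bseq (val l).

Lemma overpartition_seq_inj (n : nat) : injective (@overpartition_seq n).
Proof.
move=> l1 l2 eql; apply/val_inj/val_inj; move: eql; apply: inj_map.
by move=> [i a] [j b] /= [/val_inj -> ->].
Qed.

Lemma overpartition_complete (n : nat) (s : seq (nat * bool)) :
  is_overpartition n s <-> exists l : overpartition n, overpartition_seq l = s.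
Proof.
split=> [Hs|[l <-]]; last exact: (valP l).
have /and4P[_ /allP pos /eqP sn _] := Hs.
have szs : size [seq (inord x.1 : 'I_n.+1, x.2) | x <- s] <= n.
  rewrite size_map -(size_map fst) -/(parts s) -sn -sum1_size sumnE.
  by rewrite big_seq [leqRHS]big_seq; apply: leq_sum => i /pos.
have les x : x \in s -> x.1 <= n.
  move=> xs; rewrite -sn sumnE (big_rem x.1) ?leq_addr //=.
  exact: map_f.
have eqs : seq_of_bseq (Bseq szs) = s.
  rewrite /seq_of_bseq /= -map_comp -[RHS]map_id; apply/eq_in_map => -[k b] xs.
  by rewrite /= inordK // ltnS; exact: (les _ xs).
have Hl : is_overpartition n (seq_of_bseq (Bseq szs)) by rewrite eqs.
by exists (exist (fun t : n.-bseq _ => is_overpartition n (seq_of_bseq t)) _ Hl).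
Qed.

Lemma mex_exists (s : seq nat) : exists k, (0 < k) && (k \notin s).
Proof.
exists (sumn s).+1; apply/negP => Hk.
have : (sumn s).+1 <= sumn s by rewrite {2}sumnE (big_rem _ Hk) leq_addr.
by rewrite ltnn.
Qed.

Definition Mex (n : nat) (l : overpartition n) : nat :=
  ex_minn (mex_exists (parts (overpartition_seq l))).

Definition Mex_e (n : nat) (l : overpartition n) : nat :=
  if odd (Mex l) then 0 else Mex l.

Definition sigmaMex (n : nat) : nat := \sum_(l : overpartition n) Mex l.

Definition sigmaMex_e (n : nat) : nat := \sum_(l : overpartition n) Mex_e l.

Local Open Scope classical_set_scope.
Local Open Scope ring_scope.

(* Division by 0 is total here, but convergence of the ratio to 1 forces b to
   be eventually nonzero. *)
Definition asymp_equiv (R : realType) (a b : nat -> R) : Prop :=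
  (fun n => a n / b n) @ \oo --> (1 : R).

(* Main.v *)
(** Write [M m n] for the number of overpartitions of [n] with [Mex = m] and
    [p n] for the number of all of them, so that [sigmaMex n] is the sum of
    [m * M m n] over all [m] and [sigmaMex_e n] is the sum over even [m].

    The generating function of [M m] is the product of the factors
    [2q^i/(1-q^i)] for [i < m] and [(1+q^i)/(1-q^i)] for [i > m].  Comparing two
    consecutive ones coefficientwise gives [m * M m.+1 n <= (m + 4) * M m n] for
    [m >= 2], so [m * M m n] grows by at most a bounded multiple of
    [M m n + M m.+1 n] from [m] to [m.+1].  Pairing neighbours, the odd and the
    even part of [sigmaMex n] differ by at most [4 * p n].

    On the other hand [p n = o(sigmaMex n)]: by the same comparison it is enough
    that [M 1 n = o(p n)].  Turning one copy of a part of size [i] into [i] ones is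
    injective on overpartitions without ones, so those with many distinct sizes
    are rare; those with few distinct sizes number polynomially many in [n], while
    [p n] grows faster than any polynomial. *)

Require Import Defs.
From mathcomp Require Import all_boot all_order all_algebra.
From mathcomp Require Import all_classical all_reals all_analysis.
From mathcomp Require Import zify ring lra.

Set Implicit Arguments.
Unset Strict Implicit.
Unset Printing Implicit Defensive.

Import Order.TTheory GRing.Theory Num.Theory.

(** * Overpartitions as multiplicity functions *)

Section Coding.
Local Open Scope nat_scope.

(** Both order conditions on an overpartition in one relation: sizes decrease, and an overlined copy
    comes first among its size. Being transitive and antisymmetric, it makes a sorted sequence
    depend only on its multiset of parts. *)
Definition prec (x y : nat * bool) : bool :=
  (y.1 <= x.1) && (y.2 ==> (x.1 != y.1)).

Lemma prec_trans : transitive prec.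
Proof. by move=> [a b] [c d] [e f]; rewrite /prec /=; case: b d f => -[] [] /=; lia. Qed.

Lemma prec_anti : antisymmetric prec.
Proof.
move=> [a b] [c d]; rewrite /prec /= => H.
have -> : a = c by lia.
by have -> : b = d by move: H; case: b d => -[] //=; lia.
Qed.

Lemma is_overpartitionE n s : is_overpartition n s =
  [&& pairwise prec s, all (fun x => 0 < x.1) s & sumn (parts s) == n].
Proof.
have geq_trans : transitive geq by move=> a b c /= H1 H2; apply: leq_trans H1.
rewrite /is_overpartition /parts sorted_pairwise // pairwise_map all_map.
rewrite /prec pairwise_relI.
by do 2!case: (pairwise _ s); rewrite /= ?andbT ?andbF.
Qed.

Fixpoint of_mults (f : nat -> nat * bool) (k : nat) : seq (nat * bool) :=
  if k is i.+1 then
    nseq (f i).2 (k, true) ++ nseq (f i).1 (k, false) ++ of_mults f i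
  else [::].

Lemma of_mults_bound f k x : x \in of_mults f k -> 0 < x.1 <= k.
Proof.
elim: k => //= k IH; rewrite !mem_cat !mem_nseq => /or3P[/andP[_ /eqP->]|/andP[_ /eqP->]|/IH] /=; lia.
Qed.

Lemma pairwise_of_mults f k : pairwise prec (of_mults f k).
Proof.
elim: k => //= k IH; rewrite !pairwise_cat IH.
have H b : allrel prec (nseq b (k.+1, true)) (nseq (f k).1 (k.+1, false)).
  by apply/allrelP => x y /nseqP[-> _] /nseqP[-> _]; rewrite /prec /=; lia.
have H' b c : allrel prec (nseq c (k.+1, b)) (of_mults f k).
  apply/allrelP => x y /nseqP[-> _] /of_mults_bound; rewrite /prec /=.
  by case: y => [u []] /=; lia.
rewrite allrel_catr H !H' /= andbT; apply/andP; split; first by case: (f k).2.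
by elim: (f k).1 => //= c ->; rewrite andbT; apply/allP => y /nseqP[-> _]; rewrite /prec /=; lia.
Qed.

Lemma sumn_of_mults f k : sumn (parts (of_mults f k)) =
  \sum_(i < k) i.+1 * ((f i).1 + (f i).2).
Proof.
elim: k => [|k IH]; first by rewrite big_ord0.
rewrite big_ord_recr -IH /= /parts !map_cat !sumn_cat !map_nseq !sumn_nseq /=.
lia.
Qed.

Lemma count_of_mults f k i b : count_mem (i.+1, b) (of_mults f k) =
  (i < k) * (if b then (f i).2 : nat else (f i).1).
Proof.
elim: k b => //= k IH b; rewrite !count_cat !count_nseq /= IH !xpair_eqE eqSS.
by case: (ltngtP k i) => [?|?|->]; case: b; rewrite /= ?(ltnS, ltnn); lia.
Qed.

(** [prec] fails between two equal overlined parts. *)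
Lemma count_overlined s r : pairwise prec s ->
  count_mem (r, true) s = ((r, true) \in s).
Proof.
elim: s => //= x s IH /andP[/allP H /IH ->]; rewrite inE eq_sym.
case: eqP => //= xr; case E: (_ \in s) => //; have := H _ E.
by rewrite -xr /prec /= eqxx andbF.
Qed.

(* Index [i] stands for the size [i.+1]; the pair holds the number of
   non-overlined copies and whether there is an overlined one.  Any such pair is
   allowed, so a size contributes exactly (1 + q^i)(1 + q^i + q^2i + ...). *)
Definition config (N : nat) := {ffun 'I_N.+1 -> 'I_N.+1 * bool}.

Definition mult (N : nat) (y : 'I_N.+1 * bool) : nat := y.1 + y.2.

Definition weight (N : nat) (f : config N) : nat :=
  \sum_(i < N.+1) i.+1 * mult (f i).

Definition nat_config (N : nat) (f : config N) (i : nat) : nat * bool :=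
  (nat_of_ord (f (inord i)).1, (f (inord i)).2).

Definition code (N : nat) (s : seq (nat * bool)) : config N :=
  [ffun i : 'I_N.+1 => (inord (count_mem (i.+1, false) s), (i.+1, true) \in s)].

Lemma sumn_of_config N (f : config N) :
  sumn (parts (of_mults (nat_config f) N.+1)) = weight f.
Proof.
by rewrite sumn_of_mults; apply: eq_bigr => i _; rewrite /nat_config inord_val.
Qed.

Lemma leq_sumn (s : seq nat) x : x \in s -> x <= sumn s.
Proof. by move=> xs; rewrite sumnE (big_rem _ xs) leq_addr. Qed.

Lemma leq_size_sumn (s : seq nat) : all (fun x => 0 < x) s -> size s <= sumn s.
Proof. by elim: s => //= x s IH /andP[x0 /IH]; lia. Qed.

Lemma codeK N n s : n <= N -> is_overpartition n s ->
  of_mults (nat_config (code N s)) N.+1 = s.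
Proof.
move=> nN; rewrite is_overpartitionE => /and3P[ps /allP pos /eqP sn].
(* Both sides are sorted for [prec], so only the multiplicities remain to be compared. *)
apply: (sorted_eq prec_trans prec_anti); try exact: pairwise_sorted (pairwise_of_mults _ _).
  exact: pairwise_sorted.
have bnd x : x \in s -> 0 < x.1 <= n.
  by move=> xs; rewrite pos // -sn leq_sumn //; apply: map_f.
rewrite perm_sym.
apply/allP => -[r b] _; apply/eqP.
have [r0|r0] := posnP r.
  rewrite r0 (count_memPn _); last by apply/negP => /bnd.
  by rewrite (count_memPn _) //; apply/negP => H; have := @of_mults_bound _ N.+1 _ H.
rewrite -(prednK r0) count_of_mults /nat_config.
case: (ltnP r.-1 N.+1) => rN; last first.
  by rewrite mul0n (count_memPn _) //; apply/negP => /bnd /=; lia.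
have cN : count_mem (r.-1.+1, false) s < N.+1.
  rewrite ltnS (leq_trans (count_size _ _)) //.
  rewrite -(size_map fst) (leq_trans _ nN) // -sn leq_size_sumn //.
  by apply/allP => x /mapP[y /pos ? ->].
by rewrite mul1n ffunE !inordK //; case: b; rewrite ?count_overlined.
Qed.

Lemma of_configK N (f : config N) : code N (of_mults (nat_config f) N.+1) = f.
Proof.
apply/ffunP => i; rewrite ffunE count_of_mults -has_pred1 has_count count_of_mults.
rewrite ltn_ord !mul1n /nat_config inord_val inord_val.
by case: (f i) => c [].
Qed.

Lemma of_config_overpartition N (f : config N) n : weight f = n ->
  is_overpartition n (of_mults (nat_config f) N.+1).
Proof.
move=> <-; rewrite is_overpartitionE pairwise_of_mults sumn_of_config eqxx andbT.
by apply/allP => x /of_mults_bound/andP[].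
Qed.

Lemma mem_of_mults f k i :
  (i.+1 \in parts (of_mults f k)) = (i < k) && (0 < (f i).1 + (f i).2).
Proof.
elim: k => //= k IH; rewrite /parts !map_cat !map_nseq !mem_cat -/(parts _) IH.
rewrite !mem_nseq eqSS /=.
by case: (ltngtP k i) => [?|?|->]; rewrite /= ?(ltnS, ltnn, andbF, andbT, orbF); lia.
Qed.

Lemma mem_parts_code N n s (i : 'I_N.+1) : n <= N -> is_overpartition n s ->
  (i.+1 \in parts s) = (0 < mult (code N s i)).
Proof.
by move=> nN sP; rewrite -{1}(codeK nN sP) mem_of_mults ltn_ord /nat_config inord_val.
Qed.

Lemma weight_code N n s : n <= N -> is_overpartition n s ->
  weight (code N s) = n.
Proof.
move=> nN sP; rewrite -sumn_of_config (codeK nN sP).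
by have /and4P[_ _ /eqP] := sP.
Qed.

(** [code] is a bijection onto the configurations of weight [n]. Allowing [n <= N] lets a single
    truncation order serve several values of [n]. *)
Lemma card_config N n (P : pred (overpartition n)) (Q : pred (config N)) :
  n <= N ->
  (forall l, P l = Q (code N (overpartition_seq l))) ->
  #|[set l | P l]| = #|[set f | (weight f == n) && Q f]|.
Proof.
move=> nN PQ; pose phi (l : overpartition n) := code N (overpartition_seq l).
have lP (l : overpartition n) : is_overpartition n (overpartition_seq l) := valP l.
have phiI : injective phi.
  move=> l1 l2 e; apply: overpartition_seq_inj.
  by rewrite -(codeK nN (lP l1)) -(codeK nN (lP l2)) -!/(phi _) e.
rewrite -(card_imset _ phiI); apply: eq_card => f; rewrite inE.
apply/imsetP/andP => [[l]|[/eqP wf Qf]].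
  by rewrite inE PQ => Pl ->; rewrite /phi (weight_code nN (lP l)).
have /overpartition_complete[l el] := of_config_overpartition wf.
by exists l; rewrite ?inE ?PQ /phi el of_configK.
Qed.

(* The constraint that [Mex = m] imposes on the multiplicity [k] of the size
   [i]. *)
Definition mex_ok (m i k : nat) : bool :=
  if i < m then 0 < k else if i == m then k == 0 else true.

Lemma Mex_eq n (l : overpartition n) m : 0 < m ->
  (Mex l == m) =
  (m \notin parts (overpartition_seq l)) &&
  all (fun i => i \in parts (overpartition_seq l)) (iota 1 m.-1).
Proof.
move=> m0; rewrite /Mex; case: ex_minnP => k /andP[k0 kP] kmin.
apply/eqP/andP => [<-|[mP /allP mall]].
  split=> //; apply/allP => i; rewrite mem_iota => ik.
  apply: contraT => iP; have := kmin i; rewrite iP andbT; lia.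
have km := kmin m; rewrite m0 mP in km.
apply/eqP; rewrite eqn_leq km //= leqNgt; apply/negP => lkm.
by move/negP: kP; apply; apply: mall; rewrite mem_iota; lia.
Qed.

Lemma card_Mex N n m : 0 < m <= N.+1 -> n <= N ->
  #|[set l : overpartition n | Mex l == m]| =
  #|[set f : config N | (weight f == n) &&
       [forall i : 'I_N.+1, mex_ok m i.+1 (mult (f i))]]|.
Proof.
move=> /andP[m0 mN] nN; apply: card_config => // l; rewrite Mex_eq //.
have mem i := mem_parts_code i nN (valP l : is_overpartition n (overpartition_seq l)).
set f := code _ _ in mem *; apply/andP/forallP => [[mP /allP mall] i|H].
  rewrite /mex_ok; case: ltnP => [im|mi].
    by rewrite -mem mall // mem_iota; lia.
  by case: eqP => // im; rewrite -leqn0 leqNgt -mem im.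
have mN' : m.-1 < N.+1 by lia.
split.
  have := H (Ordinal mN'); rewrite /mex_ok /= prednK // ltnn eqxx -leqn0 leqNgt.
  by rewrite -mem /= prednK.
apply/allP => i; rewrite mem_iota => im.
have iN : i.-1 < N.+1 by lia.
have := H (Ordinal iN); rewrite /mex_ok /= prednK; last by lia.
by rewrite ifT -?mem /= ?prednK //; lia.
Qed.

End Coding.

(** * Generating polynomials modulo a power of the variable *)

Section Truncated.
Local Open Scope ring_scope.
Variable N : nat.

Definition nneg (p : {poly int}) : Prop := forall i, (i <= N)%N -> 0 <= p`_i.

Lemma nneg0 : nneg 0.
Proof. by move=> i _; rewrite coef0. Qed.

Lemma nneg1 : nneg 1.
Proof. by move=> i _; rewrite coef1. Qed.

Lemma nnegXn n : nneg 'X^n.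
Proof. by move=> i _; rewrite coefXn. Qed.

Lemma nnegD p q : nneg p -> nneg q -> nneg (p + q).
Proof. by move=> hp hq i iN; rewrite coefD addr_ge0 ?hp ?hq. Qed.

Lemma nnegM p q : nneg p -> nneg q -> nneg (p * q).
Proof.
move=> hp hq i iN; rewrite coefM sumr_ge0 // => j _.
by rewrite mulr_ge0 ?hp ?hq // (leq_trans _ iN) // ?leq_subr // -ltnS.
Qed.

Lemma nneg_sum I (r : seq I) (P : pred I) (F : I -> {poly int}) :
  (forall i, P i -> nneg (F i)) -> nneg (\sum_(i <- r | P i) F i).
Proof. by move=> H; elim/big_ind: _ => //; [exact: nneg0 | exact: nnegD]. Qed.

Lemma nneg_prod I (r : seq I) (P : pred I) (F : I -> {poly int}) :
  (forall i, P i -> nneg (F i)) -> nneg (\prod_(i <- r | P i) F i).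
Proof. by move=> H; elim/big_ind: _ => //; [exact: nneg1 | exact: nnegM]. Qed.

Lemma nnegMn p n : nneg p -> nneg (p *+ n).
Proof. by move=> hp i iN; rewrite coefMn mulrn_wge0 ?hp. Qed.

(** This discards truncation errors, whatever the sign of [p]. *)
Lemma nneg_tail p : nneg ('X^(N.+1) * p).
Proof. by move=> i iN; rewrite coefXnM ltnS iN. Qed.

Definition geom (i : nat) : {poly int} := \sum_(c < N.+1) 'X^(i * c).

(* [1/(1 - q^i)] is replaced by a polynomial, at the cost of multiples of
   ['X^(N.+1)]. *)
Lemma geomE i : (0 < i)%N ->
  (1 - 'X^i) * geom i = 1 - 'X^(N.+1) * 'X^(i.-1 * N.+1).
Proof.
move=> i0; rewrite -exprD -mulSn prednK // exprM.
rewrite -[RHS]opprB subrX1 -mulNr opprB.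
by congr (_ * _); apply: eq_bigr => c _; rewrite exprM.
Qed.

Lemma nneg_geom i : nneg (geom i).
Proof. by apply: nneg_sum => c _; exact: nnegXn. Qed.

Definition any_part (i : nat) : {poly int} :=
  \sum_(y : 'I_N.+1 * bool) 'X^(i * mult y).

Definition some_part (i : nat) : {poly int} :=
  \sum_(y : 'I_N.+1 * bool | (0 < mult y)%N) 'X^(i * mult y).

Lemma any_partE i : any_part i = (1 + 'X^i) * geom i.
Proof.
rewrite /any_part -(pair_bigA _ (fun c b => 'X^(i * mult (c, b)))) /=.
rewrite mulr_sumr; apply: eq_bigr => c _.
rewrite big_bool /mult /= addn0 addn1 mulnS exprD; ring.
Qed.

Lemma sum_no_part i :
  \sum_(y : 'I_N.+1 * bool | mult y == 0%N) 'X^(i * mult y) = 1 :> {poly int}.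
Proof.
rewrite (bigD1 (ord0, false)) //= muln0 expr0 big1 ?addr0 // => -[c b].
rewrite /mult /= addn_eq0 => /andP[/andP[c0 b0] /negP[]]; apply/eqP.
by case: b b0 => // _; congr (_, _); apply/val_inj/eqP.
Qed.

Lemma some_part_any i : some_part i = any_part i - 1.
Proof.
rewrite /any_part (bigID (fun y => mult y == 0%N)) /= sum_no_part.
rewrite addrAC subrr add0r; apply: eq_bigl => y; exact: lt0n.
Qed.

Lemma some_partE i : (0 < i)%N ->
  some_part i = 'X^i * geom i *+ 2 - 'X^(N.+1) * 'X^(i.-1 * N.+1).
Proof.
move=> i0; rewrite some_part_any any_partE.
have := geomE i0; set T := _ * 'X^(_ * _) => H.
have -> : T = 1 - (1 - 'X^i) * geom i by rewrite H; ring.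
ring.
Qed.

Lemma nneg_any_part i : nneg (any_part i).
Proof. by apply: nneg_sum => y _; exact: nnegXn. Qed.

Lemma nneg_some_part i : nneg (some_part i).
Proof. by apply: nneg_sum => y _; exact: nnegXn. Qed.

(* Modulo [T], [G] is [1/(1-a)], [G'] is [1/(1-X*a)] and [S] is [(1-a)/(1-X)];
   the terms of the right-hand side are coefficientwise nonnegative. *)
Lemma consecutive_mex_identity (A : comNzRingType) (X H S G G' a T E E' : A) (m e d : nat) :
  a = 1 - (1 - X) * S ->
  T * E = 1 - (1 - a) * G -> T * E' = 1 - (1 - X * a) * G' ->
  d%:R = e%:R *+ 2 - m%:R :> A ->
  let g := H * G' in let k := (1 - X) * H * G' in
  H * ((1 + X * a) * G') *+ (m + 4) - H * (a * G *+ 2 - T * E) *+ m =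
  (X * a * g) *+ 4 + (S * k + a * k) *+ m + k *+ 4
  + (G * (X * S * k - a * k *+ e)) *+ 4 + (a * G * k) *+ (2 * d)
  + T * (E * (X * g *+ 4 + (a * g *+ 2 + H - a * k *+ 2) *+ m)
         + E' * (- (a * G * H *+ 2) *+ m)).
Proof.
move=> aE TE TE' dE g k.
rewrite [X in _ = _ + X]mulrDr [T * (E * _)]mulrA [T * (E' * _)]mulrA TE TE'.
rewrite /k /g aE -[_ *+ (2 * d)]mulr_natr natrM dE; ring.
Qed.

Lemma nneg_consecutive_mex (H k : {poly int}) m : (1 < m)%N ->
  k = (1 - 'X) * H * geom m.+1 ->
  nneg H -> nneg k ->
  (forall j, (j < m)%N -> ~~ odd j -> nneg ((1 - 'X^j) * k)) ->
  nneg (H * any_part m.+1 *+ (m + 4) - H * some_part m *+ m).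
Proof.
move=> m1 kE H0 k0 kj; set g := H * geom m.+1.
have g0 : nneg g by apply: nnegM => //; exact: nneg_geom.
rewrite any_partE some_partE; last by lia.
have := geomE (ltn0Sn m); have := geomE (ltnW m1); rewrite (exprS _ m).
set G := geom m in kE *; set G' := geom m.+1 in kE g g0 *.
set T := 'X^(N.+1); set E := 'X^(m.-1 * _); set E' := 'X^(_ * _).
set a := 'X^m => GE GE'.
have G0 : nneg G := nneg_geom m.
have a0 : nneg a := nnegXn m.
pose S : {poly int} := \sum_(j < m) 'X^j.
have SE : (1 - 'X) * S = 1 - a by rewrite -opprB mulNr -subrX1 opprB.
have S0 : nneg S by apply: nneg_sum => j _; exact: nnegXn.
(* Only the even [j] are available, about half of all. The four copies of [block] in the identity
   remove [4 * e = 2 * m + 2 * d] copies of [a * G * k], of which [2 * d] are given back. *)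
pose e := (\sum_(j < m) ~~ odd j)%N.
have [d eE] : exists d, (e.*2 = m + d)%N.
  exists (odd m); rewrite /e; elim: (m) => [|n IH]; first by rewrite big_ord0.
  by rewrite big_ord_recr doubleD IH /=; case: (odd n); rewrite /=; lia.
(* ['X * S * k] is the sum of the ['X^(m - j) * k], each of which dominates
   [a * k] when [j] is even. *)
have block : nneg ('X * S * k - a * k *+ e).
  have -> : 'X * S * k - a * k *+ e =
      \sum_(j < m) 'X^(m - j) * (if odd j then k else (1 - 'X^j) * k).
    rewrite /e -sumrMnr mulr_sumr mulr_suml.
    rewrite (reindex_inj rev_ord_inj) /= -sumrB; apply: eq_bigr => j _.
    rewrite -exprS subnSK //; case: ifP => _; first by rewrite mulr0n subr0.
    rewrite mulr1n; have -> : a = 'X^(m - j) * 'X^j.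
      by rewrite -exprD subnK // ltnW.
    ring.
  apply: nneg_sum => j _; apply: nnegM; first exact: nnegXn.
  by case: ifPn => // oj; exact: kj.
have dE : d%:R = e%:R *+ 2 - m%:R :> {poly int}.
  by rewrite -mulrnA muln2 eE natrD addrAC subrr add0r.
have TE : T * E = 1 - (1 - a) * G by rewrite GE subKr.
have TE' : T * E' = 1 - (1 - 'X * a) * G' by rewrite GE' subKr.
have aE : a = 1 - (1 - 'X) * S by rewrite SE subKr.
have -> : H * ((1 + 'X * a) * G') *+ (m + 4) - H * (a * G *+ 2 - T * E) *+ m =
  ('X * a * g) *+ 4 + (S * k + a * k) *+ m + k *+ 4
  + (G * ('X * S * k - a * k *+ e)) *+ 4 + (a * G * k) *+ (2 * d)
  + T * (E * ('X * g *+ 4 + (a * g *+ 2 + H - a * k *+ 2) *+ m)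
         + E' * (- (a * G * H *+ 2) *+ m)).
  by rewrite kE; exact: consecutive_mex_identity.
have X0 : nneg 'X := nnegXn 1.
apply: nnegD; last exact: nneg_tail.
apply: nnegD; last exact/nnegMn/(nnegM (nnegM a0 G0)).
apply: nnegD; last by apply: nnegMn; apply: nnegM.
apply: nnegD; last exact: nnegMn.
apply: nnegD; apply: nnegMn; first exact: nnegM (nnegM X0 a0) g0.
by apply: nnegD; apply: nnegM.
Qed.

End Truncated.

(** * Coefficient comparison for consecutive minimal excludants *)

Definition mex_count (m n : nat) : nat :=
  #|[set l : overpartition n | Mex l == m]|.

Section Counting.
Local Open Scope ring_scope.

(** Expanding the product selects one pair for each size, that is, a configuration, and the exponent
    obtained is its weight. *)
Lemma coef_card_config N (A : nat -> pred nat) n :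
  (\prod_(1 <= i < N.+2)
     \sum_(y : 'I_N.+1 * bool | A i (mult y)) 'X^(i * mult y))`_n =
  #|[set f : config N | (weight f == n) &&
       [forall i : 'I_N.+1, A i.+1 (mult (f i))]]|%:R :> int.
Proof.
rewrite big_add1 big_mkord bigA_distr_big_dep.
rewrite (eq_bigl (fun f : config N => [forall i : 'I_N.+1, A i.+1 (mult (f i))]));
  last by move=> f; apply/familyP/forallP.
rewrite coef_sum -sum1_card natr_sum big_mkcond [RHS]big_mkcond.
apply: eq_bigr => f _; rewrite inE prodrXr coefXn -/(weight f) eq_sym.
by case: [forall _, _]; case: (weight f == n).
Qed.

Definition mex_poly N m : {poly int} :=
  \prod_(1 <= i < m) some_part N i * \prod_(m.+1 <= i < N.+2) any_part N i.

Lemma coef_mex_poly N m n : (0 < m <= N.+1)%N -> (n <= N)%N ->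
  (mex_poly N m)`_n = (mex_count m n)%:R.
Proof.
move=> mN nN; rewrite /mex_count (card_Mex mN nN) -coef_card_config.
congr ((polyseq _)`_n); rewrite /mex_poly [RHS](@big_cat_nat _ _ _ m) /=; try lia.
rewrite [X in _ = _ * X]big_ltn; last by lia.
rewrite [X in _ = _ * (X * _)](eq_bigl (fun y => mult y == 0%N)); last first.
  by move=> y; rewrite /mex_ok ltnn eqxx.
rewrite sum_no_part mul1r; congr (_ * _).
  apply: eq_big_nat => i im; apply: eq_bigl => y; rewrite /mex_ok ifT //; lia.
apply: eq_big_nat => i im; apply: eq_bigl => y; rewrite /mex_ok.
by rewrite ifF ?ifF //; lia.
Qed.

Lemma coef_all_poly N n : (n <= N)%N ->
  (\prod_(1 <= i < N.+2) any_part N i)`_n = #|overpartition n|%:R.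
Proof.
move=> nN; rewrite (coef_card_config N (fun _ => predT)) -cardsT.
rewrite (@card_config N n predT (fun f => [forall i : 'I_N.+1, predT (mult (f i))])) //.
by move=> l; apply/esym/forallP.
Qed.

(** Modulo ['X^(N.+1)] the product is just ['X^i *+ 2]. *)
Lemma nneg_some_partB N i : (0 < i)%N ->
  nneg N ((1 - 'X^i) * some_part N i).
Proof.
move=> i0; rewrite (some_partE _ i0) mulrBr mulrnAr mulrCA (geomE _ i0).
set T := 'X^(N.+1); set E := 'X^(_ * _).
have -> : 'X^i * (1 - T * E) *+ 2 - (1 - 'X^i) * (T * E) =
  'X^i *+ 2 + T * ((- 1 - 'X^i) * E) by move: ('X^i) => a; ring.
by apply: nnegD; [apply: nnegMn; exact: nnegXn | exact: nneg_tail].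
Qed.

Lemma leq_mex_count m n : (1 < m)%N ->
  (m * mex_count m.+1 n <= (m + 4) * mex_count m n)%N.
Proof.
move=> m1; pose N := maxn m n.
pose K := \prod_(m.+2 <= i < N.+2) any_part N i.
(* [H] is the common factor of [mex_poly N m] and [mex_poly N m.+1]. *)
pose H := \prod_(1 <= i < m) some_part N i * K.
have nnegK : nneg N K by apply: nneg_prod => i _; exact: nneg_any_part.
pose k := (1 - 'X) * H * geom N m.+1.
have nG : nneg N (geom N m.+1)  by exact: nneg_geom.
have some1 : nneg N ((1 - 'X) * some_part N 1) by exact: (@nneg_some_partB N 1).
have nS j l : nneg N (\prod_(j <= i < l) some_part N i).
  by apply: nneg_prod => i _; exact: nneg_some_part.
have HE : H = some_part N 1 * (\prod_(2 <= i < m) some_part N i * K).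
  by rewrite /H big_ltn // mulrA.
have k0 : nneg N k.
  rewrite /k HE (mulrA (1 - 'X)); apply: nnegM => //.
  exact: nnegM some1 (nnegM (nS _ _) nnegK).
(* The factor of size 1 absorbs the [1 - 'X] inside [k], and the factor of size [j] absorbs
   [1 - 'X^j]. For [j = 1] the same factor would be needed twice, hence the restriction to even
   [j]. *)
have kj j : (j < m)%N -> ~~ odd j -> nneg N ((1 - 'X^j) * k).
  case: j => [|[|j]] // jm _; first by rewrite expr0 subrr mul0r; exact: nneg0.
  rewrite /k HE (@big_cat_nat _ _ _ j.+2) //=; last exact: ltnW.
  rewrite [X in _ * X * K]big_ltn //.
  have -> (a b c d e f g h : {poly int}) : a * (b * (c * (d * (e * f) * g)) * h) =
    (b * c) * (a * e) * (d * f * g * h) by ring.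
  apply: nnegM; first by apply: nnegM => //; exact: nneg_some_partB.
  by do 3!apply: nnegM => //.
have H0 : nneg N H by exact: nnegM (nS _ _) nnegK.
have /(_ n (leq_maxr _ _)) := @nneg_consecutive_mex N H k m m1 (erefl k) H0 k0 kj.
have F : H * any_part N m.+1 = mex_poly N m.
  rewrite /mex_poly (@big_ltn _ _ _ m.+1); last by rewrite !ltnS leq_maxl.
  by rewrite /H /K; ring.
have F' : H * some_part N m = mex_poly N m.+1.
  by rewrite /mex_poly (@big_nat_recr _ _ _ m) ?(ltnW m1) //= /H /K; ring.
rewrite F F' coefB !coefMn !coef_mex_poly ?leq_maxr ?ltnS ?leq_maxl //; lia.
Qed.

(** The comparison from 1 to 2, with a shift of [n]: 2X/(1-X) = 2X(1+X)/(1-X^2) is coefficientwise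
    at most 2(X+X^2) times the factor (1+X^2)/(1-X^2) of size 2. *)
Lemma mex_count2 n :
  (mex_count 2 n.+2 <= 2 * (mex_count 1 n.+1 + mex_count 1 n))%N.
Proof.
pose N := n.+2.
pose K := \prod_(3 <= i < N.+2) any_part N i.
have nnegK : nneg N K by apply: nneg_prod => i _; exact: nneg_any_part.
have F1 : mex_poly N 1 = any_part N 2 * K.
  by rewrite /mex_poly big_geq // mul1r big_ltn.
have F2 : mex_poly N 2 = some_part N 1 * K.
  by rewrite /mex_poly big_nat1.
have G1 := @geomE N 1 isT; have G2 := @geomE N 2 isT.
have n2 : nneg N (geom N 2) by exact: nneg_geom.
have : nneg N ('X * mex_poly N 1 *+ 2 + 'X^2 * mex_poly N 1 *+ 2 - mex_poly N 2).
  rewrite F1 F2 any_partE some_partE // expr1 in G1 *.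
  move: G1 G2 n2; set T := 'X^(N.+1); set E1 := 'X^(_ * _); set E2 := 'X^(_ * _).
  set g1 := geom N 1; set g2 := geom N 2 => G1 G2 n2.
  have -> : 'X * ((1 + 'X^2) * g2 * K) *+ 2 + 'X^2 * ((1 + 'X^2) * g2 * K) *+ 2
    - ('X * g1 *+ 2 - T * E1) * K =
    ('X * (1 + 'X) * 'X^2 * g2 * K) *+ 2 +
    T * (('X * (1 + 'X) * g2 * E1 *+ 2 - 'X * E2 * g1 *+ 2 + E1) * K).
    have TE1 : T * E1 = 1 - (1 - 'X) * g1 by rewrite G1 subKr.
    have TE2 : T * E2 = 1 - (1 - 'X^2) * g2 by rewrite G2 subKr.
    move: TE1 TE2; move: ('X : {poly int}) T E1 E2 g1 g2 {G1 G2 n2} => X T E1 E2 g1 g2.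
    move=> TE1 TE2.
    rewrite -[RHS]addr0 -(mul0r K).
    have -> : T * ((X * (1 + X) * g2 * E1 *+ 2 - X * E2 * g1 *+ 2 + E1) * K) =
      (X * (1 + X) * g2 * (T * E1) *+ 2 - X * (T * E2) * g1 *+ 2 + T * E1) * K by ring.
    rewrite TE1 TE2; ring.
  have X1 : nneg N 'X := @nnegXn N 1.
  apply: nnegD; last exact: nneg_tail.
  apply: nnegMn; do 2!apply: nnegM => //.
  by apply: nnegM (@nnegXn N 2); apply: nnegM => //; exact: nnegD (@nneg1 N) X1.
move=> /(_ n.+2 (leqnn _)).
rewrite coefB coefD !coefMn coefXM coefXnM /= !subSS subn0.
rewrite !coef_mex_poly //; try lia.
Qed.

(** Multiplying by 1 - X takes differences of consecutive coefficients and reduces the factor of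
    size 1 to 1 + X, up to truncation. *)
Lemma leq_card_overpartition n : (#|overpartition n| <= #|overpartition n.+1|)%N.
Proof.
pose N := n.+1; pose K := \prod_(2 <= i < N.+2) any_part N i.
have nnegK : nneg N K by apply: nneg_prod => i _; exact: nneg_any_part.
have : nneg N ((1 - 'X) * \prod_(1 <= i < N.+2) any_part N i).
  rewrite big_ltn // any_partE expr1 -/K.
  have := @geomE N 1 isT; rewrite expr1; move: (geom N 1) => g G.
  have -> : (1 - 'X) * ((1 + 'X) * g * K) = ((1 - 'X) * g) * (1 + 'X) * K by ring.
  rewrite G -mulrA mulrBl mul1r -mulrA; apply: nnegD; last first.
    by rewrite -mulrN; exact: nneg_tail.
  by apply: nnegM => //; exact: nnegD (@nneg1 N) (@nnegXn N 1).
move=> /(_ n.+1 (leqnn _)); rewrite mulrBl mul1r coefB coefXM /=.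
by rewrite !coef_all_poly // subr_ge0 ler_nat.
Qed.

End Counting.

(** * Overpartitions without ones *)

Section FewOnes.
Local Open Scope nat_scope.

Lemma exp_dominates A B : exists K0, forall K, K0 <= K -> A * (K + 3) ^ B <= 2 ^ K.
Proof.
elim: B A => [|B IH] A.
  by exists A => K AK; rewrite muln1 (leq_trans AK) // ltnW // ltn_expl.
have [K0 HK] := IH (A * 2 ^ (B + 4)); exists K0.*2 => K K0K.
(* With K about 2L, one factor 2^L pays for the new factor K + 3 and the other for the induction
   hypothesis. *)
set L := K./2; have KL : K = odd K + L + L by rewrite -addnA addnn odd_double_half.
have /HK HL : K0 <= L by lia.
have L2 : L < 2 ^ L by exact: ltn_expl.
apply: (@leq_trans (A * (2 * (L + 3)) ^ B.+1)).
  by rewrite leq_mul2l leq_exp2r //; apply/orP; right; clear -KL; lia.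
apply: (@leq_trans (2 ^ L * 2 ^ L)); last by rewrite -expnD leq_exp2l //; lia.
have := leq_mul HL (ltnW L2).
suff: A * (2 * (L + 3)) ^ B.+1 <= A * 2 ^ (B + 4) * (L + 3) ^ B * 2 ^ L.
  by move=> H1 H2; apply: leq_trans H1 _; rewrite leq_mul.
rewrite expnMn !expnS expnD.
have -> : A * (2 * 2 ^ B * ((L + 3) * (L + 3) ^ B)) =
  (A * 2 ^ B * (L + 3) ^ B) * (2 * (L + 3)) by ring.
have -> : A * (2 ^ B * 2 ^ 4) * (L + 3) ^ B * 2 ^ L =
  (A * 2 ^ B * (L + 3) ^ B) * (16 * 2 ^ L) by ring.
by rewrite leq_mul2l; apply/orP; right; lia.
Qed.

Lemma sqrt_exists n : exists K, K * K.+1 <= n < K.+1 * K.+2.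
Proof.
elim: n => [|n [K HK]]; first by exists 0.
case: (ltnP n.+1 (K.+1 * K.+2)) => H; [exists K | exists K.+1]; lia.
Qed.

Variable N : nat.

Definition configs (n : nat) : {set config N} := [set f | weight f == n].

Definition no_ones (n : nat) : {set config N} :=
  [set f in configs n | mult (f ord0) == 0].

Definition supp (f : config N) : {set 'I_N.+1} := [set i | 0 < mult (f i)].

Lemma card_configs n : n <= N -> #|configs n| = #|overpartition n|.
Proof.
move=> nN; rewrite -cardsT (@card_config N n predT predT) //.
by apply: eq_card => f; rewrite !inE andbT.
Qed.

Lemma card_no_ones n : n <= N -> #|no_ones n| = mex_count 1 n.
Proof.
move=> nN; rewrite /mex_count (card_Mex _ nN) //; apply: eq_card => f.
rewrite !inE; congr (_ && _); apply/idP/forallP => [f0 i|/(_ ord0)//].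
rewrite /mex_ok ltnS ltn0 eqSS; case: eqP => // i0.
by have -> : i = ord0 by apply/val_inj.
Qed.

Lemma mult_eq0 (y : 'I_N.+1 * bool) : mult y = 0 -> y = (ord0, false).
Proof.
case: y => c b /eqP; rewrite /mult addn_eq0 eqb0 /= => /andP[/eqP c0 /negPf->].
by congr (_, _); apply/val_inj.
Qed.

(** Such a configuration is determined by its values on its support, listed with their indices and
    padded to length [D]. *)
Lemma card_few D n : #|[set f in configs n | #|supp f| <= D]| <=
  (N.+1 * (N.+1 * 2)) ^ D.
Proof.
(* The padding has multiplicity 0, so it cannot be mistaken for a size that occurs. *)
pose y0 : 'I_N.+1 * ('I_N.+1 * bool) := (ord0, (ord0, false)).
pose gr (f : config N) := [seq (i, f i) | i <- enum (supp f)].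
pose tau f : {ffun 'I_D -> 'I_N.+1 * ('I_N.+1 * bool)} :=
  [ffun k : 'I_D => nth y0 (gr f) k].
have key f g i : #|supp f| <= D -> tau f = tau g -> 0 < mult (f i) -> f i = g i.
  move=> fD /ffunP efg fi.
  have iS : i \in enum (supp f) by rewrite mem_enum inE.
  have kD : index i (enum (supp f)) < D.
    by apply: leq_trans fD; rewrite cardE index_mem.
  have := efg (Ordinal kD); rewrite !ffunE /= /gr.
  rewrite (nth_map ord0) ?index_mem // nth_index //.
  case: (ltnP (index i (enum (supp f))) (size (enum (supp g)))) => H.
    by rewrite (nth_map ord0) // => -[<-].
  by rewrite nth_default ?size_map // => -[_ fi0]; rewrite fi0 in fi.
have -> : (N.+1 * (N.+1 * 2)) ^ D = #|{ffun 'I_D -> 'I_N.+1 * ('I_N.+1 * bool)}|.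
  by rewrite card_ffun !card_prod !card_ord card_bool.
rewrite -(@card_in_imset _ _ tau) ?max_card // => f g.
rewrite !inE => /andP[_ fD] /andP[_ gD] efg; apply/ffunP => i.
have [f0|fi] := posnP (mult (f i)); last exact: key efg fi.
have [g0|gi] := posnP (mult (g i)); last by rewrite (key g f i).
by rewrite (mult_eq0 f0) (mult_eq0 g0).
Qed.

Lemma leq_mult_weight (f : config N) (i : 'I_N.+1) : i.+1 * mult (f i) <= weight f.
Proof. by rewrite /weight (bigD1 i) //= leq_addr. Qed.

(* One copy of the size [i.+1] becomes [i.+1] copies of [1]; the flag on the
   ones remembers whether the copy taken away was the overlined one. *)
Definition to_ones (f : config N) (i : 'I_N.+1) : config N :=
  [ffun j : 'I_N.+1 => if j == ord0 then (inord (i.+1 - (f i).2), (f i).2)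
             else if j == i then (inord (mult (f i)).-1, false) else f j].

(** The sum counts pairs of a configuration and a size in it, on which [to_ones] is injective: the
    total number of ones gives the size, and their flag with the remaining copies gives the original
    pair. *)
Lemma sum_supp_no_ones n : n <= N ->
  \sum_(f in no_ones n) #|supp f| <= #|configs n|.
Proof.
move=> nN.
pose P := [set x : config N * 'I_N.+1 | (x.1 \in no_ones n) && (x.2 \in supp x.1)].
have -> : \sum_(f in no_ones n) #|supp f| = #|P|.
  rewrite -sum1_card (eq_bigl (fun x => (x.1 \in no_ones n) && (x.2 \in supp x.1)));
    last by move=> x; rewrite inE.
  by rewrite -(pair_big_dep _ (fun f i => i \in supp f) (fun _ _ => 1)) /=;
    apply: eq_bigr => f _; rewrite sum1_card.
(* The bounds by [N] make every [inord] in [to_ones] exact. *)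
have Pfacts f i : (f, i) \in P ->
    [/\ weight f = n, f ord0 = (ord0, false), i != ord0, 0 < mult (f i) &
        i.+1 <= N /\ mult (f i) <= N].
  rewrite !inE /= => /andP[/andP[/eqP wf /eqP f0] fi]; split=> //.
  - exact: mult_eq0.
  - by apply: contraTneq fi => ->; rewrite f0.
  - have := leq_mult_weight f i; rewrite wf => le_n.
    by split; apply: leq_trans nN; apply: leq_trans le_n; rewrite ?leq_pmulr ?leq_pmull.
rewrite -(@card_in_imset _ _ (fun x => to_ones x.1 x.2)); last first.
  move=> [f i] [g j] /Pfacts[wf f0 i0 fi [iN fN]] /Pfacts[wg g0 j0 gj [jN gN]] /= /ffunP efg.
  have := efg ord0; rewrite !ffunE eqxx => -[/(congr1 val) /=].
  rewrite !inordK; try (by case: (_.2) => /=; lia).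
  move=> eij eb; have ij : i = j by apply/val_inj; move: eij; rewrite eb; case: (g j).2 => /=; lia.
  rewrite -{j}ij in j0 gj jN gN eij eb efg *; congr (_, _); apply/ffunP => k.
  have [->|k0] := eqVneq k ord0; first by rewrite f0 g0.
  have := efg k; rewrite !ffunE (negPf k0); case: eqVneq => // -> [/(congr1 val) /=].
  rewrite !inordK ?ltnS ?(leq_trans (leq_pred _)) //.
  move: fi gj; rewrite /mult; case: (f i) (g i) eb => [c b] [c' b'] /= -> fi gj e.
  by congr (_, _); apply/val_inj => /=; lia.
apply: subset_leq_card; apply/fintype.subsetP => _ /imsetP[[f i] /Pfacts[wf f0 i0 fi [iN fN]] ->] /=.
rewrite inE -wf /weight (bigD1 ord0) //= (bigD1 i) //= [X in _ == X](bigD1 ord0) //=.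
rewrite [X in _ == _ + X](bigD1 i) //= !ffunE eqxx (negPf i0) eqxx f0.
rewrite (eq_bigr (fun j : 'I_N.+1 => j.+1 * mult (f j))); last first.
  by move=> j /andP[j0 ji]; rewrite ffunE (negPf j0) (negPf ji).
rewrite {1 2}/mult /= !inordK ?ltnS ?(leq_trans (leq_pred _)) ?(leq_trans (leq_subr _ _)) //.
apply/eqP; case: (mult (f i)) fi => // c _; rewrite {2}/mult /=; case: (_.2) => /=; nia.
Qed.

(** Each [f] without ones has [D <= #|supp f|], or is among the few counted by [card_few] and is
    then charged [D]. *)
Lemma leq_no_ones D n : n <= N -> D * #|no_ones n| <=
  #|configs n| + D * (N.+1 * (N.+1 * 2)) ^ D.
Proof.
move=> nN; apply: leq_trans (leq_add (sum_supp_no_ones nN) (leqnn _)).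
apply: leq_trans (leq_add (leqnn _) (leq_mul (leqnn D) (card_few D n))).
rewrite -sum1_card !big_distrr /= -sum1_card big_distrr /=.
rewrite [X in _ <= _ + X](_ : _ =
  \sum_(f in configs n) if #|supp f| <= D then D else 0); last first.
  rewrite -big_mkcondr /=; apply: eq_big => f; rewrite ?inE ?muln1 //.
apply: (@leq_trans (\sum_(f in no_ones n) (#|supp f| + if #|supp f| <= D then D else 0))).
  by apply: leq_sum => f _; case: ifP; lia.
rewrite big_split leq_add2l /=.
rewrite [X in _ <= X](bigID (mem (no_ones n))) /= (leq_trans _ (leq_addr _ _)) //.
by rewrite leq_eqVlt; apply/orP; left; apply/eqP; apply: eq_bigl => f; rewrite !inE; case: (_ == n).
Qed.

(** Each subset of the sizes 2 to K + 1, taken once and overlined, has weight at most K(K + 1) and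
    is completed to [n] by ones. *)
Lemma expn2_leq_configs K n : n <= N -> K * K.+1 <= n -> 2 ^ K <= #|configs n|.
Proof.
move=> nN Kn; have KN : K <= N by nia.
pose h (k : 'I_K) : 'I_N.+1 := inord k.+1.
have hE k : h k = k.+1 :> nat by rewrite inordK //; have := ltn_ord k; lia.
have hI : injective h by move=> k l /(congr1 val) /=; rewrite !hE => -[/val_inj].
pose A := h @: [set: 'I_K].
have cA : #|A| = K by rewrite card_imset // cardsT card_ord.
pose w (S : {set 'I_N.+1}) := \sum_(j in S) j.+1.
pose F (S : {set 'I_N.+1}) : config N :=
  [ffun j : 'I_N.+1 => if j == ord0 then (inord (n - w S), false) else (ord0, j \in S)].
have A0 (S : {set 'I_N.+1}) : S \subset A -> ord0 \notin S.
  move/fintype.subsetP => SA; apply/negP => /SA /imsetP[k _] /(congr1 val) /=.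
  by rewrite hE.
have wS (S : {set 'I_N.+1}) : S \subset A -> w S <= n.
  move=> SA; apply: leq_trans Kn.
  apply: (@leq_trans (\sum_(j in S) K.+1)).
    apply: leq_sum => j /(fintype.subsetP SA) /imsetP[k _ ->]; rewrite hE; exact: ltn_ord.
  by rewrite sum_nat_const leq_mul2r -{2}cA subset_leq_card.
rewrite -cA -card_powerset -(@card_in_imset _ _ F); last first.
  move=> S T; rewrite !inE => SA TA /ffunP e; apply/setP => j; have := e j.
  rewrite !ffunE; case: eqVneq => [->|_ [] //].
  by rewrite (negPf (A0 _ SA)) (negPf (A0 _ TA)).
apply: subset_leq_card; apply/fintype.subsetP => _ /imsetP[S + ->]; rewrite !inE => SA.
rewrite /weight (bigD1 ord0) //= ffunE eqxx /mult /= inordK; last by lia.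
rewrite (eq_bigr (fun j : 'I_N.+1 => if j \in S then j.+1 else 0)); last first.
  by move=> j j0; rewrite ffunE (negPf j0) /=; case: (j \in S); rewrite ?muln1 ?muln0.
rewrite -big_mkcondr /= (eq_bigl (mem S)); last first.
  by move=> j; case: eqVneq => // ->; rewrite /= (negPf (A0 _ SA)).
by rewrite -/(w S) mul1n addn0 subnK // wS.
Qed.

End FewOnes.

(** * Rarity of overpartitions without ones *)

Section Ratio.
Local Open Scope nat_scope.

Lemma mex_count1_small D : exists n0, forall n, n0 <= n ->
  D * mex_count 1 n <= #|overpartition n|.
Proof.
have [->|D0] := posnP D; first by exists 0.
pose D2 := D * 2.
(* As n < (K + 1)(K + 2), the base 2(n + 1)^2 is at most 2(K + 3)^4. The error term is thus at most
   2^K, hence at most the number of overpartitions, and doubling [D] compensates for it. *)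
have [K0 HK] := exp_dominates (D2 * 2 ^ D2) (4 * D2); exists (K0 * K0.+1) => n n0.
have [K /andP[Kn nK]] := sqrt_exists n.
have KK : K0 <= K by rewrite leqNgt; apply/negP => ?; nia.
have := @leq_no_ones n D2 n (leqnn _); rewrite card_no_ones // card_configs // => H.
have := @expn2_leq_configs n K n (leqnn _) Kn; rewrite card_configs // => H2.
have : D2 * (n.+1 * (n.+1 * 2)) ^ D2 <= 2 ^ K.
  apply: leq_trans (HK K KK); rewrite -mulnA leq_mul2l; apply/orP; right.
  by rewrite expnM -expnMn; rewrite leq_exp2r ?muln_gt0 ?D0 //; clear -nK; nia.
move: H H2; rewrite /D2; nia.
Qed.
End Ratio.

(** * Sums of minimal excludants *)

Section MexSums.
Local Open Scope nat_scope.

Lemma mex_count0 n : mex_count 0 n = 0.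
Proof.
apply/eqP; rewrite cards_eq0; apply/eqP/setP => l; rewrite !inE /Mex.
by case: ex_minnP => k /andP[+ _] _; case: k.
Qed.

Lemma mex_count_small m D : exists n0, forall n, n0 <= n ->
  D * mex_count m n <= #|overpartition n|.
Proof.
case: m => [|m]; first by exists 0 => n _; rewrite mex_count0 muln0.
elim: m D => [|m IH] D; first exact: mex_count1_small.
case: m IH => [IH|m IH].
  (* Monotonicity brings the bounds at [n] and [n.+1] back to [n.+2]. *)
  have [n0 Hn] := IH (4 * D); exists n0.+2 => -[|[|n]] // n0n.
  have H1 := Hn n.+1 ltac:(lia); have H0 := Hn n ltac:(lia).
  have := leq_mul (leqnn D) (mex_count2 n).
  have := leq_card_overpartition n; have := leq_card_overpartition n.+1.
  move: H0 H1; nia.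
(* The ratio of consecutive counts is at most (m + 6)/(m + 2), so at most 3. *)
have [n0 Hn] := IH (3 * D); exists n0 => n /Hn Hn3; apply: leq_trans Hn3.
rewrite (mulnC 3) -mulnA leq_mul2l; apply/orP; right.
rewrite -(@leq_pmul2l m.+2) // (leq_trans (leq_mex_count n _)) //.
by rewrite mulnA leq_mul2r; apply/orP; right; lia.
Qed.

Lemma mex_count_small_uniform k D : exists n0, forall m n, m < k -> n0 <= n ->
  D * mex_count m n <= #|overpartition n|.
Proof.
elim: k => [|k [n0 H]]; first by exists 0.
have [n1 H1] := mex_count_small k D; exists (maxn n0 n1) => m n.
rewrite geq_max ltnS leq_eqVlt => /orP[/eqP->|mk] /andP[n0n n1n]; [exact: H1|exact: H].
Qed.

Lemma mex_countE m n : mex_count m n = \sum_(l : overpartition n) (Mex l == m).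
Proof. by rewrite /mex_count -sum1_card big_mkcond; apply: eq_bigr => l _; rewrite inE; case: eqP. Qed.

(** Eventually at most half of the overpartitions have [Mex] below 2K; each of the others
    contributes at least 2K. *)
Lemma leq_sigmaMex K : exists n0, forall n, n0 <= n ->
  K * #|overpartition n| <= sigmaMex n.
Proof.
have [->|K0] := posnP K; first by exists 0.
have [n0 H] := mex_count_small_uniform (K * 2) (4 * K); exists n0 => n n0n.
suff: K * 2 * #|overpartition n| <=
    sigmaMex n + \sum_(m < K * 2) K * 2 * mex_count m n.
  have : 2 * \sum_(m < K * 2) K * 2 * mex_count m n <= K * 2 * #|overpartition n|.
    have -> : K * 2 * #|overpartition n| = \sum_(m < K * 2) #|overpartition n|.
      by rewrite sum_nat_const card_ord.
    rewrite big_distrr /=.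
    apply: leq_sum => m _; apply: leq_trans (H m n (ltn_ord m) n0n).
    by rewrite mulnA leq_mul2r; apply/orP; right; lia.
  lia.
rewrite (eq_bigr (fun m : 'I_(K * 2) =>
    \sum_(l : overpartition n) K * 2 * (Mex l == m))); last first.
  by move=> m _; rewrite mex_countE big_distrr.
rewrite exchange_big -big_split /= mulnC -sum_nat_const; apply: leq_sum => l _.
case: (ltnP (Mex l) (K * 2)) => lK; last exact: leq_trans (leq_addr _ _).
by rewrite (bigD1 (Ordinal lK)) //= eqxx muln1 addnCA leq_addr.
Qed.

Lemma sum_by_mex n (F : nat -> nat) b : (forall l : overpartition n, Mex l < b) ->
  \sum_(l : overpartition n) F (Mex l) = \sum_(m < b) F m * mex_count m n.
Proof.
move=> lb; rewrite (eq_bigr (fun m : 'I_b =>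
    \sum_(l : overpartition n) F m * (Mex l == m))); last first.
  by move=> m _; rewrite mex_countE big_distrr.
rewrite exchange_big /=; apply: eq_bigr => l _.
rewrite (bigD1 (Ordinal (lb l))) //= eqxx muln1 big1 ?addn0 // => m.
by rewrite -val_eqE /= eq_sym => /negPf->; rewrite muln0.
Qed.

Lemma parity_balance (M : nat -> nat) j :
  (forall m, m.+1 * M m.+1 <= (m + 4) * M m + 2 * M m.+1) ->
  let O b := \sum_(m < b) (if odd m then m : nat else 0) * M m in
  let E b := \sum_(m < b) (if odd m then 0 else m : nat) * M m in
  let S b := \sum_(m < b) M m in
  O j.*2.+1 <= E j.*2.+1 + 4 * S j.*2.+1 /\
  E j.*2.+1 <= O j.*2.+1 + 4 * S j.*2.+1.
Proof.
move=> HM O E S.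
have recO b : O b.+1 = O b + (if odd b then b else 0) * M b by rewrite /O big_ord_recr.
have recE b : E b.+1 = E b + (if odd b then 0 else b) * M b by rewrite /E big_ord_recr.
have recS b : S b.+1 = S b + M b by rewrite /S big_ord_recr.
(* Each bound is proved at a cut where its pairs are complete: an odd index is paired with the even
   one before it for [O], an even index with the odd one before it for [E]. The pairs are disjoint,
   so each [M m] is charged at most 4 times. *)
suff [H1 H2] : O j.*2 <= E j.*2 + 4 * S j.*2 /\
    E j.*2.+1 <= O j.*2.+1 + 4 * S j.*2.+1.
  by split=> //; rewrite recO recE recS odd_double; lia.
elim: j => [|j [IH1 IH2]].
  by rewrite recO recE recS /= /O /E /S !big_ord0.
rewrite doubleS; have := HM j.*2; have := HM j.*2.+1.
move: IH1 IH2; rewrite !(recO, recE, recS) /= !odd_double /=; nia.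
Qed.

(** The last term makes the bound trivial for [m <= 1], where [leq_mex_count] says nothing. *)
Lemma leq_step m n : m.+1 * mex_count m.+1 n <=
  (m + 4) * mex_count m n + 2 * mex_count m.+1 n.
Proof.
case: (ltnP 1 m) => [m1|]; first by have := leq_mex_count n m1; lia.
by case: m => [|[|]] // _; lia.
Qed.

Lemma sigmaMex_balance n :
  sigmaMex n <= 2 * sigmaMex_e n + 4 * #|overpartition n| /\
  2 * sigmaMex_e n <= sigmaMex n + 4 * #|overpartition n|.
Proof.
pose j := \max_(l : overpartition n) Mex l.
have lb (l : overpartition n) : Mex l < j.*2.+1.
  by have := leq_bigmax (F := @Mex n) l; rewrite -/j; lia.
have [] := parity_balance j (fun m => leq_step m n).
rewrite -(sum_by_mex (fun m => if odd m then m else 0) lb).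
rewrite -(sum_by_mex (fun m => if odd m then 0 else m) lb).
have <- : #|overpartition n| = \sum_(m < j.*2.+1) mex_count m n.
  rewrite -sum1_card (sum_by_mex (fun=> 1) lb).
  by apply: eq_bigr => m _; rewrite mul1n.
have -> : sigmaMex n = \sum_(l : overpartition n) (if odd (Mex l) then Mex l else 0)
    + \sum_(l : overpartition n) (if odd (Mex l) then 0 else Mex l).
  by rewrite -big_split; apply: eq_bigr => l _ /=; case: ifP; rewrite ?addn0.
by rewrite -/(sigmaMex_e n); lia.
Qed.

End MexSums.

(** * Convergence of the ratio *)

Theorem corollary1p13 (R : realType) :
  @asymp_equiv R (fun n : nat => (sigmaMex n)%:R%R)
                 (fun n : nat => (2 * (sigmaMex_e n)%:R)%R).
Proof.
apply/cvgrPdist_le => e e0.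
pose K := Num.bound (4 / e)%R.
have K4 : (4 < e * K%:R)%R.
  by rewrite mulrC -ltr_pdivrMr // archi_boundP // divr_ge0 // ltW.
(* Passing from [sigmaMex n] to [2 * sigmaMex_e n] costs 4 of the 5; the remaining 1 keeps the
   denominator positive. The error [4 * p] is then below [e * K * p], hence below [e] times the
   denominator. *)
have [n0 HK] := leq_sigmaMex (K + 5); exists n0 => // n /= /HK sn.
have [H1 H2] := sigmaMex_balance n.
have p0 : (0 < #|overpartition n|)%N.
  by have := @expn2_leq_configs n 0 n (leqnn _) isT; rewrite card_configs.
move: sn H1 H2 p0; set p := #|_|; set a := sigmaMex n; set b := sigmaMex_e n.
rewrite -(ler_nat R) -(ler_nat R a) -(ler_nat R (2 * b)) -(ltr_nat R).
rewrite !(natrD, natrM) => sn H1 H2 p0.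
have b0 : (0 < 2 * b%:R :> R)%R by have : (0 <= K%:R :> R)%R := ler0n _ _; nra.
rewrite -[X in (`|X - _|)%R](divff (lt0r_neq0 b0)) -mulrBl normrM normfV.
rewrite (gtr0_norm b0) ler_pdivrMr // ler_norml; nra.
Qed.
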